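(* Let $A\in\mathbb{R}^{d\times d}$ be symmetric positive definite, $b\in\mathbb{R}^d$, $f(x)=\frac12x^\top Ax-b^\top x$ and $x_*=A^{-1}b$. Let $\eta_{k,i}=\eta_i$ for all $k$, where $\eta_i\ne\frac{1}{\sqrt{A_{i,i}}}\sin^{-1}(0)$, i.e. $\sin(\eta_i\sqrt{A_{i,i}})\ne0$, for every $i\in\{1,\dots,d\}$. Suppose $$\left|A_{i,i}\left(1+\frac{2\cos(\eta_i\sqrt{A_{i,i}})}{1-\cos(\eta_i\sqrt{A_{i,i}})}\right)\right|>\sum_{j\ne i}|A_{i,j}|\qquad\text{for all }i\in\{1,\dots,d\}.$$ Then, from any initial point $x_1\in\mathbb{R}^d$, the iterates $x_k$ of Parallel Frictionless Coordinate Hamiltonian Descent applied to $f$ with these integration times converge to $x_*$ at the asymptotic rate $\rho\left(I_d-(I_d-M)D^{-1}A\right)<1$, where $M$ is the diagonal matrix with $i$-th diagonal entry $\cos(\eta_i\sqrt{A_{i,i}})$ and $D$ is the diagonal part of $A$.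
   Context: $\rho(\cdot)$ is the spectral radius; $\sin^{-1}(0)$ denotes any $\theta\in\mathbb{R}$ with $\sin\theta=0$. ''Converges to $x_*$ at asymptotic rate $\rho$'' means $x_k\to x_*$ with $\limsup_{k\to\infty}\|x_k-x_*\|_2^{1/k}\le\rho$. Coordinate Hamiltonian Flow: $\mathsf{HF}^{(i)}_t(x_0,0)=(x_t,v_t)$ is the value at time $t$ of the solution of $\frac{dx}{dt}=v$, $\frac{dv}{dt}=-[\nabla f(x)]_i$ with $x(0)=x_0$, $v(0)=0$, where $[\nabla f(x)]_i\in\mathbb{R}^d$ is $\nabla f(x)$ with all entries except the $i$-th replaced by $0$. Parallel Frictionless Coordinate Hamiltonian Descent: from $x_1$, for $k=1,2,\dots$: for each $i\in\{1,\dots,d\}$ (in parallel) compute $(x_k^{(i)},v_k^{(i)})=\mathsf{HF}^{(i)}_{\eta_{k,i}}(x_k,0)$ and set $x_{k+1}[i]=x_k^{(i)}[i]$, where $x[i]$ is the $i$-th entry of $x$. *)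

(* Defs.v *)
From HB Require Import structures.
From mathcomp Require Import all_boot all_order all_algebra.
From mathcomp Require Import all_classical all_reals all_analysis.
From mathcomp Require Import complex.

Set Implicit Arguments.
Unset Strict Implicit.
Unset Printing Implicit Defensive.

Import Order.TTheory GRing.Theory Num.Theory numFieldNormedType.Exports.
Local Open Scope classical_set_scope.
Local Open Scope ring_scope.

Section Defs.
Variables (R : realType) (d : nat).

Definition posdef (A : 'M[R]_d) : Prop :=
  forall u : 'cV[R]_d, u != 0 -> 0 < (u^T *m A *m u) 0 0.

Definition quadratic (A : 'M[R]_d) (b : 'cV[R]_d) (x : 'cV[R]_d) : R :=
  2^-1 * (x^T *m A *m x) 0 0 - (b^T *m x) 0 0.

Definition norm2 (x : 'cV[R]_d) : R := Num.sqrt (\sum_i x i 0 ^+ 2).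

(* The eigenvalues are the complex ones, and [sup] is a maximum for d > 0:
   the set is then finite and nonempty.  For d = 0, [sup set0] is 0. *)
Definition spectral_radius (G : 'M[R]_d) : R :=
  sup [set ComplexField.Normc.normc l | l in
        [set l : R[i] | eigenvalue (map_mx (real_complex R) G) l]].

Definition gradient (f : 'cV[R]_d -> R) (x : 'cV[R]_d) : 'cV[R]_d :=
  \col_i 'D_(delta_mx i 0) f x.

Definition coord_part (i : 'I_d) (g : 'cV[R]_d) : 'cV[R]_d :=
  \col_j (if j == i then g j 0 else 0).

(* Trajectories t |-> (x_t, v_t), defined for every real time t since the
   integration times below may have either sign. *)
Definition coord_hamiltonian_solutions (f : 'cV[R]_d -> R) (i : 'I_d)
    (x0 v0 : 'cV[R]_d) : set ((R -> 'cV[R]_d) * (R -> 'cV[R]_d)) :=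
  [set xv | [/\ xv.1 0 = x0,
                xv.2 0 = v0,
                forall t : R, is_derive t 1 xv.1 (xv.2 t) &
                forall t : R,
                  is_derive t 1 xv.2 (- coord_part i (gradient f (xv.1 t)))]].

(* The constant trajectory is only a default value, returned when there is no
   solution at all. *)
Definition coord_hamiltonian_flow (f : 'cV[R]_d -> R) (i : 'I_d) (t : R)
    (x0 v0 : 'cV[R]_d) : 'cV[R]_d * 'cV[R]_d :=
  let xv := xget (cst x0, cst v0) (coord_hamiltonian_solutions f i x0 v0) in
  (xv.1 t, xv.2 t).

(* The iterates are numbered from 1: [x 0] and [eta 0] are irrelevant. *)
Definition parallel_frictionless_CHD (f : 'cV[R]_d -> R)
    (eta : nat -> 'I_d -> R) (x1 : 'cV[R]_d) (x : nat -> 'cV[R]_d) : Prop :=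
  x 1%N = x1 /\
  forall k, (1 <= k)%N -> forall i : 'I_d,
    x k.+1 i 0 = (coord_hamiltonian_flow f i (eta k i) (x k) 0).1 i 0.

Definition converges_at_asymptotic_rate (x : nat -> 'cV[R]_d)
    (xstar : 'cV[R]_d) (rho : R) : Prop :=
  x @ \oo --> xstar /\
  (limn_esup (fun k => (norm2 (x k - xstar) `^ k%:R^-1)%:E) <= rho%:E)%E.

End Defs.

(* Main.v *)
Require Import Defs.
From mathcomp Require Import all_boot all_order all_algebra.
From mathcomp Require Import all_classical all_reals all_analysis.
From mathcomp Require Import complex.
From mathcomp Require Import ring lra.

Set Implicit Arguments.
Unset Strict Implicit.
Unset Printing Implicit Defensive.

Import Order.TTheory GRing.Theory Num.Theory numFieldNormedType.Exports.
Local Open Scope classical_set_scope.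
Local Open Scope ring_scope.

(* For a quadratic f the coordinate flow is a harmonic oscillator, so one
   iteration maps the error e to G e, where G = I - P A and P = (I - M) D^-1 is
   a positive diagonal matrix.  G is similar to the symmetric matrix
   I - P^(1/2) A P^(1/2), hence diagonalizable with real eigenvalues, and the
   errors are bounded by a constant times rho(G)^k without polynomial factors.
   For an eigenvalue l of G, 1 - l is an eigenvalue of P A: it is positive since
   A is positive definite, and less than 2 by Gershgorin's theorem, diagonal
   dominance being exactly sum_{j <> i} |A_ij| < 2 / P_ii - A_ii. *)

(** * Entrywise derivatives and the gradient of a quadratic function *)

Lemma is_derive_coord (R : realType) d (f : R -> 'cV[R]_d)
    (df : 'cV[R]_d) (t : R) i :
  is_derive t 1 f df -> is_derive t 1 (fun s => f s i 0) (df i 0).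
Proof.
move=> [fd <-]; split; first exact/(derivable_mxP _ _ _).1.
by rewrite derive_mx// mxE.
Qed.

Lemma is_derive_col (R : realType) d (f : R -> 'cV[R]_d)
    (df : 'cV[R]_d) (t : R) :
  (forall i, is_derive t 1 (fun s => f s i 0) (df i 0)) -> is_derive t 1 f df.
Proof.
move=> fd; have fdv : derivable f t 1.
  by apply/derivable_mxP => i j; rewrite ord1; case: (fd i).
split=> //; rewrite derive_mx//; apply/colP => i; rewrite mxE.
by case: (fd i).
Qed.

(** On a line in direction [e], f is a polynomial of degree two in the step [h], so the difference
    quotient is affine in [h]. Symmetry of [A] merges the two cross terms, cancelling the factor
    1/2. *)
Lemma gradient_quadratic (R : realType) d (A : 'M[R]_d) (b x : 'cV[R]_d) :
  A^T = A -> gradient (quadratic A b) x = A *m x - b.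
Proof.
move=> Asym; apply/colP => i; rewrite mxE.
pose e : 'cV[R]_d := delta_mx i 0.
have quadE h : quadratic A b (h *: e + x) =
    quadratic A b x + h * (A *m x - b) i 0 + h ^+ 2 * (2^-1 * A i i).
  have trE (B : 'M[R]_1) : B^T 0 0 = B 0 0 by rewrite mxE.
  have addE (B C : 'M[R]_1) : (B + C) 0 0 = B 0 0 + C 0 0 by rewrite mxE.
  have scaleE c (B : 'M[R]_1) : (c *: B) 0 0 = c * B 0 0 by rewrite mxE.
  have eA (v : 'cV[R]_d) : (e^T *m v) 0 0 = v i 0.
    by rewrite /e trmx_delta -rowE mxE.
  have sym (u v : 'cV[R]_d) : (u^T *m A *m v) 0 0 = (v^T *m A *m u) 0 0.
    by rewrite -[LHS]trE !trmx_mul trmxK Asym mulmxA.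
  have symb (v : 'cV[R]_d) : (b^T *m v) 0 0 = (v^T *m b) 0 0.
    by rewrite -[LHS]trE trmx_mul trmxK.
  have Aii : (A *m e) i 0 = A i i by rewrite /e -colE mxE.
  rewrite /quadratic.
  have -> : (h *: e + x)^T = h *: e^T + x^T by rewrite linearD linearZ.
  rewrite !mulmxDl !mulmxDr -!scalemxAl -!scalemxAr.
  have -> : (A *m x - b) i 0 = (A *m x) i 0 - b i 0 by rewrite !mxE.
  rewrite !addE !scaleE (sym x e) !symb -!mulmxA !eA Aii.
  by field.
rewrite /derive; apply/cvg_lim => //.
have : (A *m x - b) i 0 + h * (2^-1 * A i i) @[h --> (0 : R)^'] -->
    (A *m x - b) i 0 + 0 * (2^-1 * A i i).
  apply: cvgD; first exact: cvg_cst.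
  apply: cvgMl; exact: cvg_within.
rewrite mul0r addr0; apply: cvg_trans; apply: near_eq_cvg.
near=> h; have h0 : h != 0 by near: h; exact: nbhs_dnbhs_neq.
rewrite /= quadE /GRing.scale/=; field.
Unshelve. all: by end_near. Qed.

(** * The scalar harmonic oscillator *)

Lemma is_derive_cos_scale (R : realType) (c t : R) :
  is_derive t 1 (fun s => cos (s * c)) (- (c * sin (t * c))).
Proof.
have ds : is_derive t 1 (fun s : R => s * c) c.
  by apply: is_derive_eq; rewrite scaler0 add0r /GRing.scale/= mulr1.
apply: is_derive_eq; rewrite /GRing.scale/=.
by ring.
Qed.

Lemma is_derive_sin_scale (R : realType) (c t : R) :
  is_derive t 1 (fun s => sin (s * c)) (c * cos (t * c)).
Proof.
have ds : is_derive t 1 (fun s : R => s * c) c.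
  by apply: is_derive_eq; rewrite scaler0 add0r /GRing.scale/= mulr1.
apply: is_derive_eq; rewrite /GRing.scale/=.
by ring.
Qed.

Lemma harmonic_unique (R : realType) (a : R) (z u : R -> R) :
  0 < a -> z 0 = 0 -> u 0 = 0 ->
  (forall t : R, is_derive t 1 z (u t)) ->
  (forall t : R, is_derive t 1 u (- (a * z t))) -> forall t, z t = 0.
Proof.
(* The energy [a z^2 + u^2] is conserved. *)
move=> a_gt0 z0 u0 dz du t.
have dE (s : R) : is_derive s 1 (fun s => a * (z s * z s) + u s * u s) 0.
  have dzs := dz s; have dus := du s.
  apply: is_derive_eq.
  by rewrite /GRing.scale/=; ring.
have := is_derive_0_is_cst t 0 dE; rewrite z0 u0 !mulr0 addr0 => /eqP.
rewrite -!expr2 paddr_eq0 ?sqr_ge0//; last by rewrite mulr_ge0 ?sqr_ge0 ?ltW.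
by rewrite mulf_eq0 gt_eqF//= expf_eq0/= => /andP[/eqP].
Qed.

(** * Closed form of the coordinate Hamiltonian flow *)

Section Flow.
Variables (R : realType) (d : nat) (A : 'M[R]_d) (b : 'cV[R]_d) (i : 'I_d).
Hypothesis Asym : A^T = A.
Hypothesis Aii_gt0 : 0 < A i i.

Let w := Num.sqrt (A i i).
Let e : 'cV[R]_d := delta_mx i 0.

Let w2 : w * w = A i i.
Proof. by rewrite -expr2 sqr_sqrtr// ltW. Qed.

Let w0 : w != 0. Proof. by rewrite gt_eqF// sqrtr_gt0. Qed.

Lemma quadratic_gradient_line (x0 : 'cV[R]_d) (c : R) :
  (A *m (x0 + c *: e) - b) i 0 = (A *m x0 - b) i 0 + c * A i i.
Proof.
have Ae : (A *m e) i 0 = A i i by rewrite /e -colE mxE.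
by rewrite mulmxDr -scalemxAr addrAC mxE [X in _ + X = _]mxE Ae.
Qed.

(** Coordinate [i] oscillates with frequency [w] about the minimizer of f along that coordinate.
    This explicit solution shows that the solution set is nonempty, so the flow never returns its
    default trajectory. *)
Lemma coord_hamiltonian_solutions_quadratic (x0 : 'cV[R]_d)
    (g := (A *m x0 - b) i 0) :
  coord_hamiltonian_solutions (quadratic A b) i x0 0
    (fun s => x0 + ((cos (s * w) - 1) / A i i * g) *: e,
     fun s => - (w * sin (s * w) / A i i * g) *: e).
Proof.
split=> /=.
- by rewrite mul0r cos0 subrr !mul0r scale0r addr0.
- by rewrite mul0r sin0 mulr0 !mul0r oppr0 scale0r.
- move=> t; apply: is_derive_col => j; have dc := is_derive_cos_scale w t.
  under eq_fun do rewrite [_ j 0]mxE [X in _ + X]mxE.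
  apply: is_derive_eq; rewrite /GRing.scale/= [RHS]mxE.
  by rewrite !mxE; ring.
- move=> t; apply: is_derive_col => j.
  have ds := is_derive_sin_scale w t.
  under eq_fun do rewrite [_ j 0]mxE.
  apply: is_derive_eq.
  rewrite gradient_quadratic// [RHS]mxE [X in _ = - X]mxE /GRing.scale/=.
  rewrite [e j 0]mxE eqxx andbT.
  have [->|_] := eqVneq j i; last by rewrite mulr0n; ring.
  by rewrite quadratic_gradient_line -/g -w2 /= mulr1n; field.
Qed.

(** Since [xget] selects an unspecified solution, the formula is derived for an arbitrary one, by
    uniqueness for the scalar oscillator. *)
Lemma coord_hamiltonian_flow_quadratic (t : R) (x0 : 'cV[R]_d) :
  (coord_hamiltonian_flow (quadratic A b) i t x0 0).1 i 0 =
  x0 i 0 - (1 - cos (t * w)) / A i i * (A *m x0 - b) i 0.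
Proof.
set g := (A *m x0 - b) i 0.
rewrite /coord_hamiltonian_flow; set xv := xget _ _.
have [] : coord_hamiltonian_solutions (quadratic A b) i x0 0 xv.
  exact: (xgetPex _ (ex_intro _ _ (coord_hamiltonian_solutions_quadratic x0))).
case: xv => y v /= y0 v0 dy dv.
have {}dv (s : R) j : is_derive s 1 (fun r => v r j 0)
    (if j == i then - (A *m y s - b) i 0 else 0).
  have := is_derive_coord j (dv s); rewrite gradient_quadratic// mxE mxE.
  by case: eqVneq => [->//|_]; rewrite oppr0.
have {}dy (s : R) j := is_derive_coord j (dy s).
(* Coordinates other than [i] feel no force: their velocity stays 0 and they stay at their initial
   values. *)
have yE s : y s = x0 + (y s i 0 - x0 i 0) *: e.
  apply/colP => j; rewrite !mxE eqxx andbT.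
  have [->|ji] := eqVneq j i; first by rewrite mulr1 addrC subrK.
  rewrite mulr0 addr0 -y0.
  apply: (@is_derive_0_is_cst _ (fun r => y r j 0)) => r.
  have vr : v r j 0 = 0.
    transitivity (v 0 j 0); last by rewrite v0 mxE.
    apply: (@is_derive_0_is_cst _ (fun r => v r j 0)) => q.
    by have := dv q j; rewrite (negPf ji).
  by have := dy r j; rewrite vr.
(* [z] and [u] are the differences in position and velocity from the explicit solution; the constant
   force cancels, leaving a homogeneous oscillator started at rest at 0. *)
pose z s := y s i 0 - x0 i 0 - (cos (s * w) - 1) / A i i * g.
pose u s := v s i 0 + w * sin (s * w) / A i i * g.
suff /(_ t)/eqP : forall s, z s = 0.
  by rewrite /z subr_eq0 => /eqP/(canRL (subrK _)) ->; ring.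
apply: (@harmonic_unique _ (A i i) z u) => //.
- by rewrite /z y0 subrr mul0r cos0 subrr !mul0r subrr.
- by rewrite /u v0 mxE mul0r sin0 mulr0 !mul0r addr0.
- move=> s; have dys := dy s i; have dc := is_derive_cos_scale w s.
  apply: is_derive_eq; rewrite /GRing.scale/=.
  by rewrite /u; ring.
- move=> s; have := dv s i; rewrite eqxx yE quadratic_gradient_line -/g => dvs.
  have ds := is_derive_sin_scale w s.
  apply: is_derive_eq; rewrite /GRing.scale/=.
  by rewrite /z -w2; field.
Qed.

End Flow.

(** * Diagonalization with real eigenvalues, and the spectral radius *)

Section Spectral.
Variable R : realType.
Notation toC := (real_complex R).

(** The change of basis is complex because it comes from the hermitian spectral theorem; keeping
    [lam] over [R] records that the eigenvalues are real. *)
Definition real_diagonalizable n (G : 'M[R]_n) (P Q : 'M[R[i]]_n)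
    (lam : 'rV[R]_n) : Prop :=
  P *m Q = 1%:M /\ map_mx toC G = P *m diag_mx (map_mx toC lam) *m Q.

Lemma symmetric_diagonalization n (H : 'M[R]_n) : H^T = H ->
  exists P Q lam, real_diagonalizable H P Q lam.
Proof.
move=> Hsym; pose Hc := map_mx toC H.
have Hherm : Hc \is hermsymmx.
  apply/is_hermitianmxP; rewrite expr0 scale1r; apply/matrixP => i j.
  by rewrite !mxE -[in LHS]Hsym mxE; simpc.
exists (invmx (spectralmx Hc)), (spectralmx Hc).
(* Taking real parts loses nothing: the spectrum of a hermitian matrix is real. *)
exists (map_mx (@complex.Re R) (spectral_diag Hc)); split.
  by rewrite mulVmx// spectral_unit.
have /orthomx_spectralP HE := hermitian_normalmx Hherm.
rewrite -/Hc [LHS]HE; congr (_ *m diag_mx _ *m _).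
apply/matrixP => i j; rewrite !mxE.
have /mxOverP/(_ i j) := hermitian_spectral_diag_real Hherm.
by move=> /RRe_real /esym.
Qed.

Lemma diag_mx_unit (F : fieldType) n (p : 'rV[F]_n) :
  (forall i, p 0 i != 0) -> diag_mx p \in unitmx.
Proof. by move=> p0; rewrite unitmxE det_diag unitfE; apply/prodf_neq0. Qed.

(** With [S] the square root of [diag_mx p], conjugating the symmetric matrix 1 - S A S by [S] gives
    1 - S^2 A. *)
Lemma symmetrizable_diagonalization n (p : 'rV[R]_n) (A : 'M[R]_n) :
  (forall i, 0 < p 0 i) -> A^T = A ->
  exists P Q lam, real_diagonalizable (1%:M - diag_mx p *m A) P Q lam.
Proof.
move=> p_gt0 Asym.
pose S : 'M[R]_n := diag_mx (\row_i Num.sqrt (p 0 i)).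
have Su : S \in unitmx.
  by apply: diag_mx_unit => i; rewrite mxE gt_eqF// sqrtr_gt0.
have SS : S *m S = diag_mx p.
  rewrite mulmx_diag; congr diag_mx; apply/rowP => i.
  by rewrite !mxE -expr2 sqr_sqrtr// ltW.
have [|P [Q [lam [PQ HE]]]] :=
  @symmetric_diagonalization n (1%:M - S *m A *m S).
  by rewrite linearB/= trmx1 !trmx_mul Asym tr_diag_mx mulmxA.
exists (map_mx toC S *m P), (Q *m map_mx toC (invmx S)), lam; split.
  by rewrite mulmxA -(mulmxA _ P) PQ mulmx1 -map_mxM mulmxV// map_mx1.
have -> : 1%:M - diag_mx p *m A = S *m (1%:M - S *m A *m S) *m invmx S.
  by rewrite mulmxBr mulmxBl mulmx1 mulmxV// !mulmxA SS mulmxK.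
by rewrite 2!map_mxM HE !mulmxA.
Qed.

(** [eigenvalue] refers to left eigenvectors, and row [i] of [Q] is one. *)
Lemma diagonalizable_eigenvalue n (G : 'M[R]_n) P Q lam i :
  real_diagonalizable G P Q lam -> eigenvalue (map_mx toC G) (toC (lam 0 i)).
Proof.
move=> [PQ GE]; apply/eigenvalueP; exists (row i Q).
  rewrite rowE GE !mulmxA -(mulmxA _ Q P) (mulmx1C PQ) mulmx1.
  rewrite scalemxAl; congr (_ *m _).
  by rewrite -rowE row_diag_mx !mxE.
apply/eqP => Qi0; have /(congr1 (row i)) := mulmx1C PQ.
rewrite row_mul Qi0 mul0mx => /rowP/(_ i)/eqP.
by rewrite !mxE eqxx eq_sym oner_eq0.
Qed.

(** If [v] is a left eigenvector, [v *m P] is one of the diagonal matrix; any nonzero entry of it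
    identifies [l]. *)
Lemma eigenvalue_diagonalizable n (G : 'M[R]_n) P Q lam (l : R[i]) :
  real_diagonalizable G P Q lam -> eigenvalue (map_mx toC G) l ->
  exists i, l = toC (lam 0 i).
Proof.
move=> [PQ GE] /eigenvalueP[v vG v0].
have vP0 : v *m P != 0.
  by apply: contraNneq v0 => vP; rewrite -(mulmx1 v) -PQ mulmxA vP mul0mx.
have [i vPi] : exists i, (v *m P) 0 i != 0.
  by apply/rV0Pn.
exists i; have := congr1 (fun w => (w *m P) 0 i) vG.
rewrite GE !mulmxA -(mulmxA _ Q P) (mulmx1C PQ) mulmx1 -scalemxAl.
rewrite mul_mx_diag !mxE mulrC => /(mulIf _) -> //.
by rewrite !mxE in vPi.
Qed.

(** Provides real eigenvectors, to which the order arguments below apply. *)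
Lemma eigenvalue_map_real n (G : 'M[R]_n) (l : R) :
  eigenvalue (map_mx toC G) (toC l) = eigenvalue G l.
Proof. by rewrite !eigenvalue_root_char -map_char_poly fmorph_root. Qed.

Lemma diagonalizable_spectral_radius n (G : 'M[R]_n) P Q lam :
  real_diagonalizable G P Q lam -> (forall i, `|lam 0 i| < 1) ->
  0 <= spectral_radius G < 1 /\ forall i, `|lam 0 i| <= spectral_radius G.
Proof.
move=> GPQ lam1; rewrite /spectral_radius; set E := (X in sup X).
have normcR (r : R) : ComplexField.Normc.normc (toC r) = `|r|.
  by rewrite /= expr0n/= addr0 sqrtr_sqr.
have Elam i : E `|lam 0 i|.
  exists (toC (lam 0 i)); last exact: normcR.
  exact: diagonalizable_eigenvalue GPQ.
have lamE x : E x -> exists i, x = `|lam 0 i|.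
  move=> [l /= lG <-]; have [i ->] := eigenvalue_diagonalizable GPQ lG.
  by exists i; exact: normcR.
have lam_sup i : `|lam 0 i| <= sup E.
  apply: ub_le_sup (Elam i).
  by exists 1 => x /lamE[j ->]; exact: ltW.
(* For n = 0 the set is empty and its [sup] is 0. Otherwise the supremum is bounded by the largest
   modulus, which gives the strict inequality. *)
split=> //; have [i0 _|n0] := pickP (@predT 'I_n); last first.
  suff -> : E = set0 by rewrite sup0 lexx ltr01.
  apply/eqP; apply: contraT => /set0P[x Ex].
  by have [i _] := lamE x Ex; have := n0 i.
rewrite (le_trans _ (lam_sup i0))//=.
case: (@arg_maxP _ _ _ i0 predT (fun i => `|lam 0 i|) isT) => j _ jmax.
apply: le_lt_trans (lam1 j); apply: ge_sup; first by exists `|lam 0 j|.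
by move=> x /lamE[k ->]; exact: jmax.
Qed.

(** * Location of the real eigenvalues between -1 and 1 *)

Section Bounds.
Variables (n : nat) (p : 'rV[R]_n) (A : 'M[R]_n) (l : R).
Hypothesis p_gt0 : forall i, 0 < p 0 i.
Hypothesis eigen_l : eigenvalue (1%:M - diag_mx p *m A) l.

Lemma eigenvector_relation : exists2 u : 'rV[R]_n, u != 0 &
  u *m diag_mx p *m A = (1 - l) *: u.
Proof.
have /eigenvalueP[u uG u0] := eigen_l; exists u => //.
by rewrite scalerBl scale1r -uG mulmxBr mulmx1 mulmxA opprB addrC subrK.
Qed.

(** For w = u diag(p), the eigenvector relation gives w A w^T = (1 - l) sum_i u_i^2 p_i, where the
    left side and the sum are positive. *)
Lemma eigenvalue_lt1 : posdef A -> l < 1.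
Proof.
move=> Apos; have [u u0 uE] := eigenvector_relation.
have wE i : (u *m diag_mx p) 0 i = u 0 i * p 0 i by rewrite mul_mx_diag mxE.
have w0 : (u *m diag_mx p)^T != 0.
  have /rV0Pn[i ui] := u0; apply/cV0Pn; exists i.
  by rewrite mxE wE mulf_neq0// gt_eqF.
have := Apos _ w0; rewrite trmxK uE -scalemxAl mxE mxE.
under eq_bigr do rewrite mxE wE mulrA.
rewrite pmulr_lgt0 ?subr_gt0//.
have /rV0Pn[i ui] := u0; rewrite (bigD1 i)//= ltr_wpDr//.
  by apply: sumr_ge0 => j _; rewrite mulr_ge0 ?(ltW (p_gt0 _))// -expr2 sqr_ge0.
by rewrite mulr_gt0// -expr2 exprn_even_gt0.
Qed.

(* Gershgorin's argument at a coordinate where [u *m diag_mx p] has maximal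
   modulus. *)
Lemma eigenvalue_gtN1 :
  (forall j, \sum_(i < n | i != j) `|A i j| < 2 / p 0 j - A j j) -> -1 < l.
Proof.
move=> Adom; have [u u0] := eigenvector_relation; set w := u *m _ => wA.
have wE i : w 0 i = u 0 i * p 0 i by rewrite /w mul_mx_diag mxE.
have /rV0Pn[i0 ui0] := u0.
case: (@arg_maxP _ _ _ i0 predT (fun i => `|w 0 i|) isT) => j _ jmax.
have {}jmax i : `|w 0 i| <= `|w 0 j| by exact: jmax.
have wj : 0 < `|w 0 j|.
  apply: lt_le_trans (jmax i0).
  by rewrite normr_gt0 wE mulf_neq0// gt_eqF.
rewrite ltNge; apply/negP => lN1.
(* Entry [j] of the relation, with the diagonal term moved to the right. Left eigenvectors make the
   off-diagonal sum run down column [j]. *)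
have := congr1 (fun v : 'rV_n => v 0 j) wA; rewrite mxE (bigD1 j)//= [RHS]mxE.
have -> : u 0 j = w 0 j / p 0 j by rewrite wE mulfK// gt_eqF.
move=> /(canRL (addKr _)) off.
have {}off : \sum_(i < n | i != j) w 0 i * A i j =
             ((1 - l) / p 0 j - A j j) * w 0 j.
  by rewrite off; ring.
(* The assumption l <= -1 means 1 - l >= 2. *)
have le2 : 2 / p 0 j - A j j <= (1 - l) / p 0 j - A j j.
  by rewrite lerB// ler_pM2r ?invr_gt0//; lra.
have : `|((1 - l) / p 0 j - A j j) * w 0 j| <=
       (\sum_(i < n | i != j) `|A i j|) * `|w 0 j|.
  rewrite -off mulr_suml; apply: le_trans (ler_norm_sum _ _ _) _.
  by apply: ler_sum => i _; rewrite normrM mulrC ler_wpM2l// jmax.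
rewrite normrM ler_pM2r// leNgt => /negP; apply.
apply: lt_le_trans (Adom j) _.
exact: le_trans le2 (ler_norm _).
Qed.

End Bounds.

(** In the coordinates [y] the recursion decouples into scalar geometric sequences; returning
    through [P] costs only a constant factor. *)
Lemma diagonalizable_iterates_le n (G : 'M[R]_n) P Q lam (rho : R)
    (f : nat -> 'cV[R]_n) :
  real_diagonalizable G P Q lam -> (forall i, `|lam 0 i| <= rho) ->
  (forall k, f k.+1 = G *m f k) ->
  exists2 C : R, 0 <= C & forall k i, `|f k i 0| <= C * rho ^+ k.
Proof.
move=> [PQ GE] lam_rho fS.
pose y k := Q *m map_mx toC (f k).
have yS k i : y k i 0 = toC (lam 0 i) ^+ k * y 0%N i 0.
  elim: k => [|k IHk]; first by rewrite mul1r.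
  rewrite exprS -mulrA -IHk {1}/y fS map_mxM GE !mulmxA (mulmx1C PQ) mul1mx.
  by rewrite -mulmxA mul_diag_mx !mxE.
(* Summing over all rows makes the constant independent of the coordinate. Norms in [R[i]] are
   complex-valued, hence the real part taken below. *)
pose K : R[i] := \sum_i \sum_j `|P i j| * `|y 0%N j 0|.
have K0 : 0 <= K.
  by apply: sumr_ge0 => i _; apply: sumr_ge0 => j _; rewrite mulr_ge0.
have KE : toC (complex.Re K) = K by apply/RRe_real/ger0_real.
have normC (r : R) : `|toC r| = toC `|r|.
  by rewrite normc_def /= expr0n/= addr0 sqrtr_sqr.
exists (complex.Re K); first by rewrite -ler0c KE.
move=> k i; rewrite -lecR rmorphM rmorphXn/= KE -normC.
have -> : toC (f k i 0) = \sum_j P i j * (toC (lam 0 j) ^+ k * y 0%N j 0).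
  have -> : toC (f k i 0) = (P *m y k) i 0.
    by rewrite /y mulmxA PQ mul1mx mxE.
  by rewrite mxE; apply: eq_bigr => j _; rewrite yS.
apply: le_trans (ler_norm_sum _ _ _) _.
rewrite /K [X in _ <= X * _](bigD1 i)//= mulrDl ler_wpDr//.
  rewrite mulr_ge0 ?exprn_ge0//.
    by apply: sumr_ge0 => ? _; apply: sumr_ge0 => ? _; rewrite mulr_ge0.
  by rewrite ler0c (le_trans _ (lam_rho i)).
rewrite mulr_suml; apply: ler_sum => j _.
rewrite !normrM normrX normC mulrCA [leRHS]mulrC ler_wpM2r ?mulr_ge0//.
by rewrite lerXn2r ?nnegrE ?lecR ?ler0c// (le_trans _ (lam_rho i)).
Qed.

End Spectral.

(** * From geometric bounds to the asymptotic rate *)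

Lemma limn_esup_root_le (R : realType) (u : nat -> R) (C rho : R) :
  0 <= rho -> (forall k, 0 <= u k) -> (forall k, u k.+1 <= C * rho ^+ k) ->
  (limn_esup (fun k => (u k `^ k%:R^-1)%:E) <= rho%:E)%E.
Proof.
move=> rho0 u0 uC; apply/lee_addgt0Pr => e e0.
(* Working with [rho + e] allows division even when [rho] is 0, and the slack absorbs both [C] and
   the index shift. *)
have r0 : 0 < rho + e by rewrite ltr_wpDl.
pose V := [set k | (0 < k)%N /\ u k <= (rho + e) ^+ k].
have V_near : \oo V.
  have q1 : `|rho / (rho + e)| < 1.
    by rewrite ger0_norm ?divr_ge0// ?(ltW r0)// ltr_pdivrMr// mul1r ltrDl.
  have /cvgrPdist_lt/(_ _ r0)[N _ NP] :
      C * (rho / (rho + e)) ^+ k @[k --> \oo] --> C * 0.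
    by apply: cvgMr; exact: cvg_expr.
  exists N.+1 => // -[//|k] /= Nk; split=> //.
  have := NP k Nk; rewrite /= mulr0 sub0r normrN => /ltW
    /(le_trans (ler_norm _)).
  rewrite expr_div_n mulrA ler_pdivrMr ?exprn_gt0// -exprS.
  exact: le_trans.
(* The upper limit is an infimum, over sets of the filter, of suprema; [V] is one such set. *)
apply: le_trans (ereal_inf_lbound _) _; first by exists V.
apply: ge_ereal_sup => _ [k [k0 uk] <-]; rewrite -EFinD lee_fin.
have <- : ((rho + e) ^+ k) `^ k%:R^-1 = rho + e.
  rewrite -powR_mulrn 1?ltW// -powRrM mulfV ?powRr1 1?ltW//.
  by rewrite pnatr_eq0 -lt0n.
by apply: ge0_ler_powR; rewrite ?nnegrE ?invr_ge0 ?exprn_ge0// ltW.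
Qed.

Lemma converges_geometric (R : realType) d (x : nat -> 'cV[R]_d) xstar
    (C rho : R) :
  0 <= C -> 0 <= rho < 1 ->
  (forall k i, `|(x k.+1 - xstar) i 0| <= C * rho ^+ k) ->
  converges_at_asymptotic_rate x xstar rho.
Proof.
move=> C0 /andP[rho0 rho1] xC.
have Crho k : 0 <= C * rho ^+ k by rewrite mulr_ge0 ?exprn_ge0.
split; last first.
  (* The Euclidean norm is at most sqrt d times a common bound on the entries. *)
  apply: (@limn_esup_root_le _ _ (Num.sqrt d%:R * C)) => // k.
    by rewrite sqrtr_ge0.
  rewrite /norm2 -mulrA -[X in _ <= _ * X]ger0_norm// -sqrtr_sqr.
  rewrite -sqrtrM ?ler0n// ler_wsqrtr//.
  rewrite mulr_natl -[d in leRHS]card_ord -sumr_const; apply: ler_sum => i _.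
  by rewrite -real_normK ?num_real// lerXn2r ?nnegrE.
(* The shift discards the irrelevant value [x 0]. *)
rewrite -cvg_shiftS; apply/cvgrPdist_le => e e0.
have : C * rho ^+ k @[k --> \oo] --> C * 0.
  by apply: cvgMr; apply: cvg_expr; rewrite ger0_norm.
move=> /cvgrPdist_le/(_ _ e0); apply: filterS => k.
rewrite mulr0 sub0r normrN ger0_norm// => ke.
rewrite /Num.Def.normr/= mx_normrE bigmax_le ?(ltW e0)//= => -[i j] _ /=.
by rewrite ord1 -opprB mxE normrN (le_trans (xC k i)).
Qed.

(** * Consequences of the hypotheses and the convergence theorem *)

Lemma posdef_diag_gt0 (R : realType) d (A : 'M[R]_d) i : posdef A -> 0 < A i i.
Proof.
move=> /(_ (delta_mx i 0)); rewrite trmx_delta -rowE -colE !mxE; apply.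
by apply/cV0Pn; exists i; rewrite mxE !eqxx oner_eq0.
Qed.

Lemma posdef_unitmx (R : realType) d (A : 'M[R]_d) : posdef A -> A \in unitmx.
Proof.
move=> Apos; rewrite -row_free_unit -kermx_eq0; apply/rowV0P => v /sub_kermxP vA.
apply/eqP; apply: contraT => v0; have := Apos v^T.
by rewrite trmx_eq0 trmxK vA mul0mx mxE ltxx => /(_ v0).
Qed.

(** Turns the condition on the integration times into positivity of 1 - cos and 1 + cos, hence of
    the diagonal scaling [p]. *)
Lemma cos_sin_neq0_itv (R : realType) (t : R) : sin t != 0 -> -1 < cos t < 1.
Proof.
move=> s0; rewrite -ltr_norml -(@ltr_pXn2r _ 2) ?nnegrE// expr1n.
rewrite real_normK ?num_real// -(cos2Dsin2 t) ltrDl.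
by rewrite exprn_even_gt0.
Qed.

Theorem theorem8 (R : realType) (d : nat) (A : 'M[R]_d) (b : 'cV[R]_d)
    (Asym : A^T = A) (Apos : posdef A)
    (eta : nat -> 'I_d -> R) (eta0 : 'I_d -> R)
    (eta_const : forall k, (1 <= k)%N -> forall i, eta k i = eta0 i)
    (eta_sin : forall i, sin (eta0 i * Num.sqrt (A i i)) != 0)
    (Adom : forall i : 'I_d,
      \sum_(j < d | j != i) `|A i j| <
      `| A i i * (1 + 2 * cos (eta0 i * Num.sqrt (A i i)) /
                      (1 - cos (eta0 i * Num.sqrt (A i i)))) |)
    (x1 : 'cV[R]_d) (x : nat -> 'cV[R]_d)
    (x_iter : parallel_frictionless_CHD (quadratic A b) eta x1 x) :
  let xstar := invmx A *m b in
  let M : 'M[R]_d := diag_mx (\row_i cos (eta0 i * Num.sqrt (A i i))) in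
  let D : 'M[R]_d := diag_mx (\row_i A i i) in
  let rho := spectral_radius (1%:M - (1%:M - M) *m invmx D *m A) in
  converges_at_asymptotic_rate x xstar rho /\ rho < 1.
Proof.
move=> xstar M D rho; pose c i := cos (eta0 i * Num.sqrt (A i i)).
pose p : 'rV[R]_d := \row_i ((1 - c i) / A i i).
pose G : 'M[R]_d := 1%:M - diag_mx p *m A.
have a_gt0 i : 0 < A i i by exact: posdef_diag_gt0.
have c1 i : -1 < c i < 1 by exact: cos_sin_neq0_itv.
have p_gt0 i : 0 < p 0 i.
  by rewrite mxE divr_gt0// subr_gt0; case/andP: (c1 i).
have DV : invmx D = diag_mx (\row_i (A i i)^-1).
  have DD : D *m diag_mx (\row_i (A i i)^-1) = 1%:M.
    rewrite mulmx_diag -diag_const_mx; congr diag_mx; apply/rowP => i.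
    by rewrite !mxE mulfV// gt_eqF.
  by rewrite -[LHS]mulmx1 -DD mulKmx//; case/mulmx1_unit: DD.
have GE : 1%:M - (1%:M - M) *m invmx D *m A = G.
  rewrite /G; congr (_ - _ *m _).
  rewrite DV -diag_const_mx -raddfB mulmx_diag; congr diag_mx.
  by apply/rowP => i; rewrite !mxE.
have [P [Q [lam GPQ]]] := symmetrizable_diagonalization p_gt0 Asym.
have lam1 i : `|lam 0 i| < 1.
  have := diagonalizable_eigenvalue i GPQ; rewrite eigenvalue_map_real => lamG.
  rewrite ltr_norml (eigenvalue_lt1 p_gt0 lamG)// andbT.
  apply: (eigenvalue_gtN1 p_gt0 lamG) => j.
  have /andP[cN1 cl1] := c1 j; have cB : 0 < 1 - c j by rewrite subr_gt0.
  (* Dominance is assumed along rows, whereas the eigenvalue bound uses columns; symmetry identifies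
     the two. *)
  have -> : \sum_(i < d | i != j) `|A i j| = \sum_(i < d | i != j) `|A j i|.
    by apply: eq_bigr => k _; rewrite -[in LHS]Asym mxE.
  apply: lt_le_trans (Adom j) _; rewrite -/(c j) mxE.
  (* This quantity is positive, so the absolute value drops, and it equals 2 / p_j - A_jj. *)
  have -> : A j j * (1 + 2 * c j / (1 - c j)) = A j j * ((1 + c j) / (1 - c j)).
    by field; rewrite gt_eqF.
  rewrite ger0_norm; last first.
    by rewrite mulr_ge0 ?ltW// divr_gt0//; lra.
  by rewrite le_eqVlt; apply/orP; left; apply/eqP; field; rewrite !gt_eqF.
have [rho01 lam_rho] := diagonalizable_spectral_radius GPQ lam1.
rewrite /rho GE; split; last by case/andP: rho01.
(* The error sequence is indexed from [x 1], the first genuine iterate. *)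
have fS k : x k.+2 - xstar = G *m (x k.+1 - xstar).
  have [_ xS] := x_iter; apply/colP => i.
  rewrite mxE xS// eta_const// coord_hamiltonian_flow_quadratic//.
  have -> : A *m x k.+1 - b = A *m (x k.+1 - xstar).
    by rewrite mulmxBr mulKVmx// posdef_unitmx.
  rewrite /G mulmxBl mul1mx -mulmxA mul_diag_mx !mxE -/(c i); ring.
have [C C0 fC] := diagonalizable_iterates_le GPQ lam_rho fS.
exact: converges_geometric C0 rho01 fC.
Qed.
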